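(* Consider online combinatorial optimization with full information over $T$ rounds with decision set $\mathcal{S}\subseteq\{0,1\}^d$ satisfying $\|\boldsymbol v\|_1\le m$ for all $\boldsymbol v\in\mathcal S$. For every $\eta>0$, the total expected regret of the Follow-the-Perturbed-Leader algorithm (FPL) with parameter $\eta$ satisfies $$\widehat R_T\le\frac{m\left(\log(d/m)+1\right)}{\eta}+\eta m\sum_{t=1}^T\mathbb E\left[\boldsymbol V_t^{\mathsf T}\boldsymbol\ell_t\right].$$ In particular, defining $L_T^*=\min_{\boldsymbol v\in\mathcal S}\boldsymbol v^{\mathsf T}\boldsymbol L_T$, where $\boldsymbol L_T=\sum_{t=1}^T\boldsymbol\ell_t$, and setting $$\eta=\min\left\{\sqrt{\frac{\log(d/m)+1}{L_T^*}},\ \frac12\right\},$$ the expected regret of FPL satisfies $$\widehat R_T\le4m\max\left\{\sqrt{L_T^*\left(\log\frac dm+1\right)},\ (m^2+1)\left(\log\frac dm+1\right)\right\}.$$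
   Context: **Problem.** Let $1\le m\le d$ and $T\ge1$ be integers and let $\mathcal S\subseteq\{0,1\}^d$ be a nonempty finite set with $\|\boldsymbol v\|_1\le m$ for all $\boldsymbol v\in\mathcal S$. In each round $t=1,\dots,T$ the learner draws a random action $\boldsymbol V_t\in\mathcal S$, the environment chooses a loss vector $\boldsymbol\ell_t\in[0,1]^d$, the learner suffers loss $\boldsymbol V_t^{\mathsf T}\boldsymbol\ell_t$ and (full information) observes the whole vector $\boldsymbol\ell_t$. The environment is non-oblivious: $\boldsymbol\ell_t$ may depend in an arbitrary fashion on the previous actions $\boldsymbol V_1,\dots,\boldsymbol V_{t-1}$ (but not on the learner's randomness in round $t$). **Expected regret.** $\widehat R_T=\max_{\boldsymbol v\in\mathcal S}\sum_{t=1}^T\mathbb E\big[(\boldsymbol V_t-\boldsymbol v)^{\mathsf T}\boldsymbol\ell_t\big]$. **Algorithm FPL with parameter $\eta>0$.** In round $t$ draw $\boldsymbol Z_t\in\mathbb R^d$, independent of the past, with i.i.d. standard (unit mean) exponential components, and play $\boldsymbol V_t=\arg\min_{\boldsymbol v\in\mathcal S}\boldsymbol v^{\mathsf T}(\eta\boldsymbol L_{t-1}-\boldsymbol Z_t)$, where $\boldsymbol L_t=\sum_{s=1}^t\boldsymbol\ell_s$ (the minimizer is almost surely unique).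
   Formalization: The ''in particular'' bound is stated for runs in which L_T^* is almost surely a constant: for a non-oblivious environment L_T^* may be random and depend on η, so that the tuned η and the right-hand side are not numbers. If L_T^*=0, η is read as 1/2. *)

(* Defs.v *)
From HB Require Import structures.
From mathcomp Require Import all_boot all_order all_algebra.
From mathcomp Require Import all_classical all_reals all_analysis.

Set Implicit Arguments.
Unset Strict Implicit.
Unset Printing Implicit Defensive.

Import Order.TTheory GRing.Theory Num.Theory.
Import numFieldNormedType.Exports.

Local Open Scope classical_set_scope.
Local Open Scope ring_scope.

(* An element of {0,1}^d; its l1-norm is the natural number \sum_i v i. *)
Definition action (d : nat) := {ffun 'I_d -> bool}.

Definition dot (R : realType) (d : nat) (v : action d) (x : 'I_d -> R) : R :=
  \sum_(i < d) (v i)%:R * x i.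

Section Independence.
Context (disp : measure_display) (Omega : measurableType disp) (R : realType).
Variable P : probability Omega R.

Definition independent_systems (F G : set (set Omega)) : Prop :=
  forall A B, F A -> G B -> P (A `&` B) = (P A * P B)%E.

(* Taking some of the sets B i equal to setT gives the product rule over every
   subfamily. *)
Definition mutually_independent (n : nat) (X : 'I_n -> {RV P >-> R}) : Prop :=
  forall B : 'I_n -> set R, (forall i, measurable (B i)) ->
    P (\bigcap_(i in [set: 'I_n]) (X i @^-1` B i)) =
    (\prod_(i < n) P (X i @^-1` B i))%E.

Definition sigma_of (n : nat) (X : 'I_n -> {RV P >-> R}) : set (set Omega) :=
  <<s [set A | exists i (B : set R), measurable B /\ A = X i @^-1` B] >>.

End Independence.

(* Rounds are numbered 0, ..., T-1 instead of 1, ..., T: the loss vector and the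
   perturbation of round t are [ell t] and [Z t], with coordinates in 'I_d. *)
Section OnlineOptimization.
Context (disp : measure_display) (Omega : measurableType disp) (R : realType).
Variables (P : probability Omega R) (d T : nat).
Implicit Types (ell Z : 'I_T -> 'I_d -> {RV P >-> R}).
Implicit Types (V : 'I_T -> Omega -> action d) (S : {set action d}).

(* Sum of the loss vectors of the first k rounds: [cumloss ell t] is the
   cumulative loss strictly before round t, and [cumloss ell T] the total. *)
Definition cumloss ell (k : nat) (w : Omega) (i : 'I_d) : R :=
  \sum_(s < T | (s < k)%N) ell s i w.

(* Everything that has happened when Z t is drawn: all earlier perturbations,
   actions and losses, and the loss vector of round t itself. *)
Definition past ell Z V (t : 'I_T) : set (set Omega) :=
  <<s [set A | exists (s : 'I_T) (i : 'I_d) (B : set R),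
          [/\ (s < t)%N, measurable B & A = Z s i @^-1` B]]
    `|` [set A | exists (s : 'I_T) (v : action d),
          (s < t)%N /\ A = V s @^-1` [set v]]
    `|` [set A | exists (s : 'I_T) (i : 'I_d) (B : set R),
          [/\ (s <= t)%N, measurable B & A = ell s i @^-1` B]] >>.

(* Independence of Z t from [past ell Z V t] leaves the environment free to let
   ell t depend in any way on the past (and on randomness of its own), but not
   on Z t. Ties in the argmin, an event of probability 0, may be broken in any
   measurable way. *)
Record FPL S (eta : R) ell Z V : Prop := {
  FPL_exponential : forall t i (B : set R), measurable B ->
    P (Z t i @^-1` B) = exponential_prob 1 B;
  FPL_indep : forall t, mutually_independent (Z t);
  FPL_fresh : forall t,
    independent_systems P (past ell Z V t) (sigma_of (Z t));
  FPL_measurable : forall t v, measurable (V t @^-1` [set v]);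
  FPL_action : forall t w, V t w \in S;
  FPL_argmin : forall t w v, v \in S ->
    dot (V t w) (fun i => eta * cumloss ell t w i - Z t i w) <=
    dot v (fun i => eta * cumloss ell t w i - Z t i w) }.

Definition expected_loss ell V : \bar R :=
  (\sum_(t < T) 'E_P[fun w => dot (V t w) (fun i => ell t i w)])%E.

(* The unit -oo is irrelevant: S is nonempty. *)
Definition regret S ell V : \bar R :=
  (\big[maxe/-oo]_(v in S) \sum_(t < T)
     'E_P[fun w => (dot (V t w) (fun i => ell t i w)
                    - dot v (fun i => ell t i w))%R])%E.

(* The random variable L_T^*; the unit +oo is irrelevant as S is nonempty. *)
Definition best_loss S ell (w : Omega) : \bar R :=
  (\big[mine/+oo]_(v in S) (dot v (cumloss ell T w))%:E)%E.

End OnlineOptimization.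

Definition logterm (R : realType) (d m : nat) : R := ln (d%:R / m%:R) + 1.

(* Division by 0 yields 0 in a field type, whereas here logterm / 0 stands for
   +oo, so that the minimum is 1/2. *)
Definition tuned_eta (R : realType) (d m : nat) (Lstar : R) : R :=
  if Lstar == 0 then 1 / 2
  else Num.min (Num.sqrt (logterm R d m / Lstar)) (1 / 2).

(* Main.v *)
(**
  Let g(y) be the minimum of v.y over v in S and Phi(x) = E g(x - Z), for Z an
  iid exponential vector. Both are concave and nondecreasing. Since V_t attains
  g at eta L_{t-1} - Z_t, it is a supergradient there, and freezing the past
  (independent of Z_t) bounds E[V_t.l_t] by the left difference quotients of
  E Phi at eta L_{t-1} in direction l_t; no discussion of ties is needed.
  Memorylessness gives P(v leads at x + h) >= exp(- v.h) P(v leads at x) for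
  h >= 0: shift the perturbation by h on the coordinates of v. Hence, for every
  step size s <= eta with s m <= 1,
    s (1 - s m) E[V_t.l_t] <= E Phi(eta L_t) - E Phi(eta L_{t-1}),
  and telescoping, with Phi(eta L_T) <= eta L_T^* and
  Phi(0) >= - m (ln(d/m) + 1), yields
    s (1 - s m) E[total loss] <= eta E[L_T^*] + m (ln(d/m) + 1).
  The first bound is s = eta. For the tuned bound take s = eta if
  eta m <= 1/2, and s = 1/(2m) otherwise, when s = eta would give nothing useful.
*)
Require Import Defs.
From HB Require Import structures.
From mathcomp Require Import all_boot all_order all_algebra.
From mathcomp Require Import all_classical all_reals all_analysis.
From mathcomp Require Import measurable_realfun ring lra.

Set Implicit Arguments.
Unset Strict Implicit.
Unset Printing Implicit Defensive.

Import Order.TTheory GRing.Theory Num.Theory.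
Import numFieldNormedType.Exports.

Local Open Scope classical_set_scope.
Local Open Scope ring_scope.

(** * Integrals of real functions under a probability *)

Section ProbabilityIntegrals.
Context (disp : measure_display) (T : measurableType disp) (R : realType).
Variable P : probability T R.
Implicit Types f g : T -> R.

Lemma bounded_integrable f (C : R) : measurable_fun setT f ->
  (forall w, `|f w| <= C) -> P.-integrable setT (EFin \o f).
Proof.
move=> mf fC.
apply: (@le_integrable _ _ _ P setT measurableT _ (EFin \o cst C)) => //=.
- exact/measurable_EFinP.
- by move=> w _; rewrite lee_fin (le_trans (fC w)) ?ler_norm.
- by apply: finite_measure_integrable_cst.
Qed.

Lemma dominated_integrable f g : measurable_fun setT f ->
  P.-integrable setT (EFin \o g) -> (forall w, `|f w| <= g w) ->
  P.-integrable setT (EFin \o f).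
Proof.
move=> mf ig fg.
apply: (@le_integrable _ _ _ P setT measurableT _ (EFin \o g)) => //=.
- exact/measurable_EFinP.
- by move=> w _; rewrite lee_fin (le_trans (fg w)) ?ler_norm.
Qed.

Lemma integrable_sum_EFin (I : Type) (r : seq I) (F : I -> T -> R) :
  (forall i, P.-integrable setT (EFin \o F i)) ->
  P.-integrable setT (EFin \o (fun w => \sum_(i <- r) F i w)).
Proof.
move=> iF; rewrite (_ : _ \o _ = fun w => (\sum_(i <- r) (F i w)%:E)%E).
  by apply: integrable_sum => // i _; exact: iF.
by apply/funext => w /=; rewrite sumEFin.
Qed.

Lemma integrable_prob_cst (c : R) : P.-integrable setT (EFin \o (fun=> c)).
Proof. exact: finite_measure_integrable_cst. Qed.

Lemma integrable_EFinZ f (a : R) : P.-integrable setT (EFin \o f) ->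
  P.-integrable setT (EFin \o (fun w => a * f w)).
Proof. by move=> fi; exact: (integrableZl measurableT a fi). Qed.

Lemma integrable_EFinB f g : P.-integrable setT (EFin \o f) ->
  P.-integrable setT (EFin \o g) ->
  P.-integrable setT (EFin \o (fun w => f w - g w)).
Proof. by move=> fi gi; exact: (integrableB measurableT fi gi). Qed.

Lemma integrable_EFinD f g : P.-integrable setT (EFin \o f) ->
  P.-integrable setT (EFin \o g) ->
  P.-integrable setT (EFin \o (fun w => f w + g w)).
Proof. by move=> fi gi; exact: (integrableD measurableT fi gi). Qed.

Lemma Rintegral_sum (I : Type) (r : seq I) (F : I -> T -> R) :
  (forall i, P.-integrable setT (EFin \o F i)) ->
  \int[P]_w (\sum_(i <- r) F i w) = \sum_(i <- r) \int[P]_w F i w.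
Proof.
move=> iF; elim: r => [|i r ih].
  under eq_Rintegral do rewrite big_nil.
  by rewrite big_nil Rintegral_cst// mul0r.
under eq_Rintegral do rewrite big_cons.
by rewrite RintegralD ?ih ?big_cons//; exact: integrable_sum_EFin.
Qed.

Lemma Rintegral_prob_cst (c : R) : \int[P]_(_ in setT) c = c.
Proof.
rewrite Rintegral_cst// (_ : fine _ = 1) ?mulr1//.
exact: (congr1 fine (probability_setT P)).
Qed.

End ProbabilityIntegrals.

(** * Exponential perturbations *)

Section ExponentialVariable.
Context (disp : measure_display) (Omega : measurableType disp) (R : realType).
Variables (P : probability Omega R) (Z : {RV P >-> R}).
Hypothesis Z_exp :
  forall B : set R, measurable B -> P (Z @^-1` B) = exponential_prob 1 B.

Let mZ (B : set R) : measurable B -> measurable (Z @^-1` B).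
Proof. by move=> mB; rewrite -[X in measurable X]setTI; exact: measurable_funP. Qed.

Lemma exponential_neg_null : P (Z @^-1` `]-oo, 0[) = 0%E.
Proof.
rewrite Z_exp// /exponential_prob; apply: integral0_eq => x /=.
by rewrite in_itv/= => x0; rewrite lt0_exponential_pdf.
Qed.

Lemma exponential_nonneg : {ae P, forall w, 0 <= Z w}.
Proof.
exists (Z @^-1` `]-oo, 0[); split; [exact: mZ|exact: exponential_neg_null|].
by move=> w /= /negP; rewrite -ltNge in_itv.
Qed.

Lemma exponential_tail (x : R) :
  P (Z @^-1` `]x, +oo[) = (expR (- Num.max x 0))%:E.
Proof.
have step (y : R) : 0 < y -> P (Z @^-1` `]y, +oo[) = (expR (- y))%:E.
  move=> y0.
  have -> : Z @^-1` `]y, +oo[ = ~` (Z @^-1` `]-oo, 0[ `|` Z @^-1` `[0, y]).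
    apply/seteqP; split => w /=; rewrite !in_itv/= ?andbT.
      by move=> yw [w0|/andP[_ wy]]; lra.
    move=> /not_orP[/negP]; rewrite -leNgt => w0 /negP.
    by rewrite w0/= -ltNge.
  rewrite probability_setC; last by apply: measurableU; exact: mZ.
  have -> : P (Z @^-1` `]-oo, 0[ `|` Z @^-1` `[0, y]) = (1 - expR (- y))%:E.
    transitivity (P (Z @^-1` `]-oo, 0%R[) + P (Z @^-1` `[0%R, y]))%E.
      apply: measureU; [exact: mZ|exact: mZ|].
      apply/seteqP; split => w //= []; rewrite !in_itv/= => w0 /andP[].
      by rewrite leNgt w0.
    rewrite exponential_neg_null add0e Z_exp// exponential_prob_itv0c// mulN1r.
    by rewrite EFinB.
  by rewrite -EFinB; congr EFin; ring.
case: (ltP 0 x) => [x0|x0]; first exact: step.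
rewrite oppr0 expR0.
apply/eqP; rewrite eq_le probability_le1/=; last exact: mZ.
apply/lee_addgt0Pr => e e0.
apply: (@le_trans _ _ (P (Z @^-1` `]e, +oo[) + e%:E)%E); last first.
  rewrite leeD2r//; apply: le_measure; rewrite ?inE; [exact: mZ..|].
  move=> w /=; rewrite !in_itv/= !andbT; apply: le_lt_trans.
  exact: le_trans x0 (ltW e0).
rewrite step// -EFinD lee_fin.
by have := expR_ge1Dx (- e); lra.
Qed.

Lemma exponential_memoryless (a : R) (B : set R) : 0 <= a -> measurable B ->
  P (Z @^-1` (B `&` `]a, +oo[)) =
  ((expR (- a))%:E * P (Z @^-1` [set x | B (x + a)%R]))%E.
Proof.
move=> a0 mB.
have mD : measurable (`]a, +oo[ : set R) by [].
pose shift := fun w => Z w + a.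
have mshift : measurable_fun setT shift by apply: measurable_funD.
pose Zs : {RV P >-> R} := HB.pack shift (isMeasurableFun.Build _ _ _ _ _ mshift).
pose r : {nonneg R} := NngNum (expR_ge0 (- a)).
pose m1 : {measure set R -> \bar R} := mrestr (distribution P Z) mD.
pose m2 : {measure set R -> \bar R} := mscale r (distribution P Zs).
suff /(_ B mB) : forall A, measurable A -> m1 A = m2 A by [].
apply: (measure_unique (@RGenOInfty.G R) (fun k => `](- k%:R)%R, +oo[%classic)).
- exact: RGenOInfty.measurableE.
- move=> _ _ [x ->] [y ->]; exists (Num.max x y).
  by apply/seteqP; split => z /=; rewrite !in_itv/= !andbT gt_max => /andP.
- by move=> k; exists (- k%:R).
- apply/seteqP; split => // x _; exists (Num.truncn `|x|).+1 => //=.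
  rewrite in_itv/= andbT ltrNl (le_lt_trans (ler_norm _))// normrN.
  by have /andP[] := Num.Theory.truncn_itv (normr_ge0 x).
- move=> _ [x ->]; 
  change (P (Z @^-1` (`]x, +oo[ `&` `]a, +oo[)) =
    ((expR (- a))%:E * P (shift @^-1` `]x, +oo[%classic))%E).
  have -> : shift @^-1` `]x, +oo[ = Z @^-1` `](x - a), +oo[.
    by apply/seteqP; split => w /=; rewrite !in_itv/= !andbT ltrBlDr.
  have -> : Z @^-1` (`]x, +oo[ `&` `]a, +oo[) = Z @^-1` `](Num.max x a), +oo[.
    by apply/seteqP; split => w /=; rewrite !in_itv/= !andbT gt_max => /andP.
  rewrite !exponential_tail -EFinM -expRD -opprD; congr (expR (- _))%:E.
  by case: (leP x a) => ?; case: (leP (x - a) 0) => ?; case: leP => ?; lra.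
- by move=> k; rewrite ltey_eq fin_num_measure.
Qed.

Lemma exponential_excess (c : R) : 0 <= c ->
  (\int[P]_w (Num.max (Z w - c) 0)%:E = (expR (- c))%:E)%E.
Proof.
move=> c0.
have mY : measurable_fun setT (fun w => Num.max (Z w - c) 0).
  by apply: measurable_maxr => //; apply: measurable_funB.
pose Y : {RV P >-> R} := HB.pack (fun w => Num.max (Z w - c) 0)
  (isMeasurableFun.Build _ _ _ _ _ mY).
have := @ge0_expectation_ccdf _ _ _ P Y.
rewrite expectation_def => ->; last first.
  by move=> w /=; rewrite le_max lexx orbT.
transitivity (\int[lebesgue_measure]_(r in `[0%R, +oo[)
     ((expR (- c))%:E * (exponential_pdf 1 r)%:E))%E.
  apply: eq_integral => r; rewrite inE/= in_itv/= andbT => r0.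
  rewrite /ccdf /distribution /pushforward/=.
  have -> : Y @^-1` `]r, +oo[ = Z @^-1` `](r + c), +oo[.
    apply/seteqP; split => w /=; rewrite !in_itv/= !andbT lt_max.
      by rewrite (ltNge r 0) r0/= orbF ltrBrDr.
    by rewrite ltrBrDr => ->.
  rewrite exponential_tail max_l ?addr_ge0// exponential_pdfE// -EFinM.
  by rewrite mul1r mulN1r opprD expRD mulrC.
rewrite ge0_integralZl//; last 2 first.
- apply/measurable_EFinP; apply: measurable_funTS; exact: measurable_exponential_pdf.
- by move=> x _; rewrite lee_fin exponential_pdf_ge0.
rewrite (_ : integral _ _ _ = 1%E) ?mule1//.
rewrite -(@integral_exponential_pdf R 1)// integral_mkcond.
apply: eq_integral => x _; rewrite patchE; case: ifPn => //.
rewrite notin_setE/= in_itv/= andbT => /negP; rewrite -ltNge => x0.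
by rewrite lt0_exponential_pdf.
Qed.

Lemma exponential_integrable : P.-integrable setT (EFin \o Z).
Proof.
have mY : measurable_fun setT (fun w => Num.max (Z w - 0) 0).
  by apply: measurable_maxr => //; apply: measurable_funB.
apply/integrableP; split; first exact/measurable_EFinP.
rewrite (@ge0_ae_eq_integral _ _ _ P setT _ (fun w => (Num.max (Z w - 0) 0)%:E)) //.
- by rewrite exponential_excess// ltry.
- by apply: measurableT_comp => //; exact/measurable_EFinP.
- exact/measurable_EFinP.
- by move=> w _; rewrite lee_fin le_max lexx orbT.
apply: filterS exponential_nonneg => w w0 _ /=.
by rewrite ger0_norm// subr0 max_l.
Qed.

Lemma exponential_mean : \int[P]_w Z w = 1.
Proof.
have mY : measurable_fun setT (fun w => Num.max (Z w - 0) 0).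
  by apply: measurable_maxr => //; apply: measurable_funB.
rewrite /Rintegral (@ae_eq_integral _ _ _ P setT
  (fun w => (Num.max (Z w - 0) 0)%:E)) //; last 3 first.
- exact/measurable_EFinP.
- exact/measurable_EFinP.
- apply: filterS exponential_nonneg => w w0 _ /=.
  by rewrite subr0 max_l.
by rewrite exponential_excess// oppr0 expR0.
Qed.

End ExponentialVariable.
Section TupleMeasure.
Context (R : realType) (d : nat).

Definition rect (B : 'I_d -> set R) : set (d.-tuple R) :=
  [set z | forall i, B i (tnth z i)].

Lemma measurable_rect (B : 'I_d -> set R) :
  (forall i, measurable (B i)) -> measurable (rect B).
Proof.
move=> mB.
rewrite (_ : rect B = \bigcap_(i in [set: 'I_d]) ((@tnth d R)^~ i @^-1` B i)).
  apply: fin_bigcap_measurable => // i _.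
  by rewrite -[X in measurable X]setTI; exact: measurable_tnth.
by apply/seteqP; split => z h i; [move=> _; exact: h|exact: (h i I)].
Qed.

Lemma tuple_measure_unique (m1 m2 : {measure set (d.-tuple R) -> \bar R}) :
  (m1 setT < +oo)%E ->
  (forall B, (forall i, measurable (B i)) -> m1 (rect B) = m2 (rect B)) ->
  forall A, measurable A -> m1 A = m2 A.
Proof.
move=> m1T m12.
pose G : set (set (d.-tuple R)) :=
  [set A | exists B, (forall i, measurable (B i)) /\ A = rect B].
have GT : G setT.
  by exists (fun=> setT); split => //; apply/seteqP; split.
apply: (measure_unique G (fun=> setT)) => //.
- apply/seteqP; split.
    apply: smallest_sub; first exact: smallest_sigma_algebra.
    rewrite -bigcup_seq => A [i /= _ [B mB <-]]; apply: sub_sigma_algebra.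
    exists (fun j => if j == i then B else setT); split.
      by move=> j; case: ifP.
    rewrite setTI; apply/seteqP; split => z /=.
      by move=> Bz j; case: eqP => // ->.
    by move=> /(_ i); rewrite eqxx.
  apply: smallest_sub; first exact: sigma_algebra_measurable.
  by move=> _ [B [mB ->]]; exact: measurable_rect.
- move=> _ _ [B [mB ->]] [C [mC ->]]; exists (fun i => B i `&` C i); split.
    by move=> i; exact: measurableI.
  apply/seteqP; split => z /=; first by move=> [Bz Cz] i.
  by move=> h; split => i; have [] := h i.
- by apply/seteqP; split => // z _; exists 0%N.
- by move=> _ [B [mB ->]]; exact: m12.
Qed.

Definition tshift (a : 'I_d -> R) (z : d.-tuple R) : d.-tuple R :=
  [tuple tnth z i + a i | i < d].

Lemma measurable_tshift a : measurable_fun setT (tshift a).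
Proof.
apply/measurable_fun_tnthP => i.
rewrite (_ : _ \o _ = fun z => tnth z i + a i); last first.
  by apply/funext => z /=; rewrite tnth_mktuple.
by apply: measurable_funD => //; exact: measurable_tnth.
Qed.

End TupleMeasure.

Section ExponentialVector.
Context (R : realType) (d : nat) (mu : probability (d.-tuple R) R).

Definition iid_exponential := forall B : 'I_d -> set R,
  (forall i, measurable (B i)) ->
  mu (rect B) = (\prod_(i < d) exponential_prob 1 (B i))%E.

Hypothesis mu_exp : iid_exponential.

Definition coord (i : 'I_d) : {RV mu >-> R} :=
  HB.pack (fun z : d.-tuple R => tnth z i)
    (isMeasurableFun.Build _ _ _ _ _ (@measurable_tnth _ R d i)).

Lemma coord_exponential i (B : set R) : measurable B ->
  mu (coord i @^-1` B) = exponential_prob 1 B.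
Proof.
move=> mB; pose C j := if j == i then B else setT.
rewrite (_ : _ @^-1` B = rect C).
  rewrite mu_exp; last by move=> j; rewrite /C; case: ifP.
  rewrite (bigD1 i)//= big1 ?mule1; first by rewrite /C eqxx.
  move=> j ji; rewrite /C (negbTE ji).
  by rewrite /exponential_prob integral_exponential_pdf.
apply/seteqP; split => z /=; rewrite /C.
  by move=> Bz j; case: eqP => // ->.
by move=> /(_ i); rewrite eqxx.
Qed.

Lemma vector_memoryless (a : 'I_d -> R) (A : set (d.-tuple R)) :
  (forall i, 0 <= a i) -> measurable A ->
  mu (A `&` rect (fun i => `]a i, +oo[%classic)) =
  ((expR (- \sum_(i < d) a i))%:E * mu (tshift a @^-1` A))%E.
Proof.
move=> a0 mA.
have mD : measurable (rect (fun i => `]a i, +oo[%classic)).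
  by apply: measurable_rect.
pose r : {nonneg R} := NngNum (expR_ge0 (- \sum_(i < d) a i)).
pose S : {RV mu >-> d.-tuple R} := HB.pack (tshift a)
  (isMeasurableFun.Build _ _ _ _ _ (measurable_tshift a)).
pose m1 : {measure set (d.-tuple R) -> \bar R} := mrestr mu mD.
pose m2 : {measure set (d.-tuple R) -> \bar R} := mscale r (distribution mu S).
suff /(_ A mA) : forall A, measurable A -> m1 A = m2 A by [].
apply: tuple_measure_unique.
  by rewrite /m1 /= /mrestr setTI ltey_eq fin_num_measure.
move=> B mB.
change (mu (rect B `&` rect (fun i => `]a i, +oo[%classic)) =
  ((expR (- \sum_(i < d) a i))%:E * mu (tshift a @^-1` rect B))%E).
rewrite (_ : _ `&` _ = rect (fun i => B i `&` `]a i, +oo[%classic)); last first.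
  apply/seteqP; split => z /=; first by move=> [Bz Cz] i.
  by move=> h; split => i; have [] := h i.
rewrite (_ : _ @^-1` _ = rect (fun i => [set x | B i (x + a i)])); last first.
  by apply/seteqP; split => z /= h i; have := h i; rewrite tnth_mktuple.
have mBs i : measurable [set x | B i (x + a i)].
  rewrite -[X in measurable X]setTI.
  by apply: (measurable_funD (@measurable_id _ _ setT) (measurable_cst (a i))).
rewrite !mu_exp//; last by move=> i; exact: measurableI.
rewrite -sumrN expR_sum -prodEFin -big_split/=; apply: eq_bigr => i _.
rewrite -!(coord_exponential i)//; last exact: measurableI.
exact: (exponential_memoryless (coord_exponential i)).
Qed.

End ExponentialVector.
(** * Perturbed leaders *)

Section Dot.
Context (R : realType) (d : nat).
Implicit Types (v : action d) (x y : 'I_d -> R).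

Lemma dotD v x y : dot v (fun i => x i + y i) = dot v x + dot v y.
Proof. by rewrite /dot -big_split; apply: eq_bigr => i _; rewrite mulrDr. Qed.

Lemma dotB v x y : dot v (fun i => x i - y i) = dot v x - dot v y.
Proof. by rewrite /dot -sumrB; apply: eq_bigr => i _; rewrite mulrBr. Qed.

Lemma dotZ v a x : dot v (fun i => a * x i) = a * dot v x.
Proof. by rewrite /dot mulr_sumr; apply: eq_bigr => i _; rewrite mulrCA. Qed.

Lemma dot_sum v (I : Type) (r : seq I) (Q : pred I) (F : I -> 'I_d -> R) :
  dot v (fun i => \sum_(s <- r | Q s) F s i) = \sum_(s <- r | Q s) dot v (F s).
Proof.
rewrite /dot exchange_big; apply: eq_bigr => i _.
by rewrite mulr_sumr.
Qed.

Lemma le_dot v x y : (forall i, x i <= y i) -> dot v x <= dot v y.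
Proof. by move=> xy; apply: ler_sum => i _; rewrite ler_wpM2l// ler0n. Qed.

Lemma dot_ge0 v x : (forall i, 0 <= x i) -> 0 <= dot v x.
Proof. by move=> x0; apply: sumr_ge0 => i _; rewrite mulr_ge0// ler0n. Qed.

Lemma eq_dot v x y : (forall i, v i -> x i = y i) -> dot v x = dot v y.
Proof.
move=> xy; apply: eq_bigr => i _.
by case: (boolP (v i)) => [/xy ->//|_]; rewrite !mul0r.
Qed.

Lemma dot_le_card (m : nat) v x : (\sum_(i < d) v i <= m)%N ->
  (forall i, x i <= 1) -> dot v x <= m%:R.
Proof.
move=> vm x1; apply: (@le_trans _ _ (\sum_(i < d) (v i)%:R)).
  by apply: ler_sum => i _; rewrite ler_piMr// ler0n.
by rewrite -natr_sum ler_nat.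
Qed.

Lemma norm_dot_le v x : `|dot v x| <= \sum_(i < d) `|x i|.
Proof.
apply: le_trans (ler_norm_sum _ _ _) _; apply: ler_sum => i _.
by case: (v i); rewrite ?mul1r// mul0r normr0.
Qed.

End Dot.

Section Leader.
Context (R : realType) (d : nat) (S : {set action d}).
Hypothesis S_neq0 : S != finset.set0.
Implicit Types (u v : action d) (x y h : 'I_d -> R).

(* Ties are broken by the enumeration rank: with this rule a leader stays the
   leader when the losses of coordinates outside of it increase. *)
Definition wins y v : bool :=
  (v \in S) && [forall u in S, (dot v y < dot u y) ||
     (dot v y == dot u y) && (enum_rank v <= enum_rank u)%N].

Lemma winsP y v : reflect (v \in S /\ forall u, u \in S -> dot v y < dot u y \/
  dot v y = dot u y /\ (enum_rank v <= enum_rank u)%N) (wins y v).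
Proof.
apply: (iffP andP) => -[vS h]; split => //.
  move=> u uS; have /forall_inP/(_ u uS)/orP[->|/andP[/eqP -> ->]] := h; first by left.
  by right.
by apply/forall_inP => u /h [->//|[-> ->]]; rewrite eqxx orbT.
Qed.

Lemma wins_exists y : exists v, wins y v.
Proof.
have [v0 v0S] := set0Pn _ S_neq0.
pose u0 := [arg min_(u < v0 in S) dot u y]%O.
have [u0S u0min] : u0 \in S /\ forall u, u \in S -> dot u0 y <= dot u y.
  by rewrite /u0; case: arg_minP.
have u0M : (u0 \in S) && (dot u0 y == dot u0 y) by rewrite u0S eqxx.
case: (arg_minnP (fun v : action d => enum_rank v : nat) (P := fun v =>
  (v \in S) && (dot v y == dot u0 y)) u0M) => v /andP[vS /eqP vu0] vmin.
exists v; apply/winsP; split => // u uS; rewrite vu0.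
have := u0min u uS; rewrite le_eqVlt => /orP[/eqP e|]; last by left.
by right; split => //; apply: vmin; rewrite uS e eqxx.
Qed.

Lemma wins_inj y u v : wins y u -> wins y v -> u = v.
Proof.
move=> /winsP[uS hu] /winsP[vS hv].
have [uv|[uv ruv]] := hu v vS; have [vu|[vu rvu]] := hv u uS.
- by have := lt_trans uv vu; rewrite ltxx.
- by rewrite vu ltxx in uv.
- by rewrite uv ltxx in vu.
- by apply: enum_rank_inj; apply/val_inj/eqP; rewrite eqn_leq ruv.
Qed.

Lemma wins_increase y h v : wins y v -> (forall i, 0 <= h i) ->
  (forall i, v i -> h i = 0) -> wins (fun i => y i + h i) v.
Proof.
move=> /winsP[vS hv] h0 hv0; apply/winsP; split => // u uS.
have -> : dot v (fun i => y i + h i) = dot v y.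
  by apply: eq_dot => i /hv0 ->; rewrite addr0.
rewrite dotD; have := dot_ge0 u h0.
rewrite le_eqVlt => /orP[/eqP <-|hu]; first by rewrite addr0; exact: hv.
by left; have [|[->]] := hv u uS; lra.
Qed.

Definition leader y : action d :=
  odflt (finfun (fun=> false)) [pick v | wins y v].

Lemma leader_wins y : wins y (leader y).
Proof.
rewrite /leader; case: pickP => [v //|none].
by have [v] := wins_exists y; rewrite none.
Qed.

Lemma leader_in y : leader y \in S.
Proof. by have /winsP[] := leader_wins y. Qed.

Lemma winsE y v : wins y v = (v == leader y).
Proof.
apply/idP/eqP => [vw|->]; last exact: leader_wins.
exact: wins_inj vw (leader_wins y).
Qed.

Definition minloss y : R := dot (leader y) y.

Lemma minloss_le y u : u \in S -> minloss y <= dot u y.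
Proof.
move=> uS; have /winsP[_ /(_ u uS)] := leader_wins y.
by move=> [/ltW//|[<-]].
Qed.

Lemma minloss_attained y v : v \in S -> (forall u, u \in S -> dot v y <= dot u y) ->
  dot v y = minloss y.
Proof.
move=> vS vmin; apply/eqP; rewrite eq_le minloss_le// andbT.
exact/vmin/leader_in.
Qed.

Lemma minlossZ (a : R) y :
  0 <= a -> minloss (fun i => a * y i) = a * minloss y.
Proof.
move=> a0; rewrite -[RHS]dotZ; apply/esym/minloss_attained => //.
  exact: leader_in.
by move=> u uS; rewrite !dotZ ler_wpM2l//; exact: minloss_le.
Qed.

Lemma le_minloss x y : (forall i, x i <= y i) -> minloss x <= minloss y.
Proof.
move=> xy; apply: le_trans (le_dot _ xy).
exact/minloss_le/leader_in.
Qed.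

Lemma minloss_add x h : minloss x + dot (leader (fun i => x i + h i)) h <=
  minloss (fun i => x i + h i).
Proof. by rewrite /minloss dotD lerD2r; exact/minloss_le/leader_in. Qed.

Lemma norm_minloss_le y : `|minloss y| <= \sum_(i < d) `|y i|.
Proof. exact: norm_dot_le. Qed.

Lemma leader_sum (F : action d -> R) y :
  F (leader y) = \sum_v F v * (wins y v)%:R.
Proof.
rewrite (bigD1 (leader y))//= winsE eqxx mulr1 big1 ?addr0// => v vl.
by rewrite winsE (negbTE vl) mulr0.
Qed.

Lemma measurable_dot disp (T : measurableType disp) (X : T -> 'I_d -> R) v :
  (forall i, measurable_fun setT (fun w => X w i)) ->
  measurable_fun setT (fun w => dot v (X w)).
Proof.
move=> mX; apply: measurable_sum => i.
exact: measurable_funM.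
Qed.

Lemma measurable_wins disp (T : measurableType disp) (X : T -> 'I_d -> R) v :
  (forall i, measurable_fun setT (fun w => X w i)) ->
  measurable [set w | wins (X w) v].
Proof.
move=> mX; have [vS|vS] := boolP (v \in S); last first.
  rewrite (_ : mkset _ = set0)//; apply/seteqP; split => w //=.
  by rewrite /wins (negbTE vS).
have mdot u := measurable_dot u mX.
have mset (b : T -> bool) : measurable_fun setT b -> measurable [set w | b w].
  move=> mb; have /(_ measurableT [set true] I) := mb.
  by rewrite setTI.
rewrite (_ : mkset _ = \bigcap_(u in [set u | u \in S])
    ([set w | dot v (X w) < dot u (X w)] `|`
     ([set w | dot v (X w) <= dot u (X w)] `&`
      [set w | (enum_rank v <= enum_rank u)%N]))).
  apply: fin_bigcap_measurable => // u _; apply: measurableU.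
    by apply: mset; exact: measurable_fun_ltr.
  apply: measurableI; first by apply: mset; exact: measurable_fun_ler.
  by apply: mset; exact: measurable_cst.
apply/seteqP; split => w /=.
  move=> /winsP[_ h] u /= /h[vu|[-> r]]; first by left.
  by right.
move=> h; apply/winsP; split => // u uS.
have [vu|[/=]] := h u uS; first by left.
by rewrite le_eqVlt => /orP[/eqP ->|] r; [right|left].
Qed.

Lemma measurable_minloss disp (T : measurableType disp) (X : T -> 'I_d -> R) :
  (forall i, measurable_fun setT (fun w => X w i)) ->
  measurable_fun setT (fun w => minloss (X w)).
Proof.
move=> mX; rewrite (_ : (fun w => _) =
    fun w => \sum_v dot v (X w) * \1_[set w | wins (X w) v] w).
  apply: measurable_sum => v; apply: measurable_funM; first exact: measurable_dot.
  exact/measurable_indic/measurable_wins.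
apply/funext => w; rewrite /minloss (leader_sum (fun v => dot v (X w))).
by apply: eq_bigr => v _; rewrite indicE; congr (_ * (nat_of_bool _)%:R);
apply/idP/idP; rewrite inE.
Qed.

End Leader.
(** * The potential and its increments *)

Section Potential.
Context (R : realType) (d : nat) (mu : probability (d.-tuple R) R).
Hypothesis mu_exp : iid_exponential mu.
Context (S : {set action d}) (m : nat).
Hypothesis S_neq0 : S != finset.set0.
Hypothesis S_le_m : forall v : action d, v \in S -> (\sum_(i < d) v i <= m)%N.
Implicit Types (v : action d) (x y h l : 'I_d -> R) (z : d.-tuple R).

Definition perturb x z : 'I_d -> R := fun i => x i - tnth z i.

Definition potential x : R := \int[mu]_z minloss S (perturb x z).

Definition leadloss x l : R := \int[mu]_z dot (leader S (perturb x z)) l.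

Definition winprob x v : R := \int[mu]_z \1_[set z | wins S (perturb x z) v] z.

Lemma measurable_perturb x i : measurable_fun setT (fun z => perturb x z i).
Proof.
by apply: measurable_funB; [exact: measurable_cst|exact: measurable_tnth].
Qed.

Lemma coord_integrable i : mu.-integrable setT (EFin \o (fun z => tnth z i)).
Proof. exact: (exponential_integrable (coord_exponential mu_exp i)). Qed.

Lemma coord_mean i : \int[mu]_z tnth z i = 1.
Proof. exact: (exponential_mean (coord_exponential mu_exp i)). Qed.

Lemma dot_tnth_integrable v :
  mu.-integrable setT (EFin \o (fun z => dot v (tnth z))).
Proof.
apply: integrable_sum_EFin => i.
apply: integrable_EFinZ; exact: coord_integrable.
Qed.

Lemma minloss_integrable x :
  mu.-integrable setT (EFin \o (fun z => minloss S (perturb x z))).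
Proof.
apply: (@dominated_integrable _ _ _ _ _
  (fun z => \sum_(i < d) (`|x i| + `|tnth z i|))).
- by apply: measurable_minloss => // i; exact: measurable_perturb.
- apply: integrable_sum_EFin => i.
  apply: integrable_EFinD.
    exact: integrable_prob_cst.
  exact: (integrable_norm (coord_integrable i)).
- move=> z; apply: le_trans (norm_minloss_le _ _) _.
  by apply: ler_sum => i _; exact: ler_normB.
Qed.

Lemma leader_integrable x l :
  mu.-integrable setT (EFin \o (fun z => dot (leader S (perturb x z)) l)).
Proof.
apply: (@bounded_integrable _ _ _ _ _ (\sum_(i < d) `|l i|)); last first.
  by move=> z; exact: norm_dot_le.
rewrite (_ : (fun z => _) =
    fun z => \sum_v dot v l * \1_[set z | wins S (perturb x z) v] z).
  apply: measurable_sum => v; apply: measurable_funM; first exact: measurable_cst.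
  by apply/measurable_indic/measurable_wins => i; exact: measurable_perturb.
apply/funext => z; rewrite (leader_sum S_neq0 (fun v => dot v l)).
by apply: eq_bigr => v _; rewrite indicE; congr (_ * (nat_of_bool _)%:R);
  apply/idP/idP; rewrite inE.
Qed.

Lemma measurable_wins_perturb x v : measurable [set z | wins S (perturb x z) v].
Proof. by apply: measurable_wins => i; exact: measurable_perturb. Qed.

Lemma winprobE x v : (winprob x v)%:E = mu [set z | wins S (perturb x z) v].
Proof.
rewrite /winprob /Rintegral integral_indic ?setIT//; last first.
  exact: measurable_wins_perturb.
by rewrite fineK// fin_num_measure//; exact: measurable_wins_perturb.
Qed.

Lemma leadlossE x l : leadloss x l = \sum_v dot v l * winprob x v.
Proof.
rewrite /leadloss.
have iw v : mu.-integrable setT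
    (EFin \o (fun z => \1_[set z | wins S (perturb x z) v] z : R)).
  by apply: integrable_indic; exact: measurable_wins_perturb.
transitivity (\int[mu]_z
    (\sum_v dot v l * \1_[set z | wins S (perturb x z) v] z)).
  apply: eq_Rintegral => z _; rewrite (leader_sum S_neq0 (fun v => dot v l)).
  by apply: eq_bigr => v _; rewrite indicE; congr (_ * (nat_of_bool _)%:R);
    apply/idP/idP; rewrite inE.
rewrite Rintegral_sum => [|v].
  by apply: eq_bigr => v _; rewrite RintegralZl.
exact: integrable_EFinZ.
Qed.

Lemma le_potential x y : (forall i, x i <= y i) -> potential x <= potential y.
Proof.
move=> xy; apply: le_Rintegral => //; try exact: minloss_integrable.
by move=> z _; apply: le_minloss => // i; rewrite /perturb lerD2r.
Qed.

Lemma perturbD x h z :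
  perturb (fun i => x i + h i) z = (fun i => perturb x z i + h i).
Proof. by apply/funext => i; rewrite /perturb addrAC. Qed.

Lemma potential_add_ge x h :
  potential x + leadloss (fun i => x i + h i) h <= potential (fun i => x i + h i).
Proof.
rewrite -RintegralD//; [|exact: minloss_integrable|exact: leader_integrable].
apply: le_Rintegral => //; last first.
- by move=> z _; rewrite perturbD; exact: minloss_add.
- exact: minloss_integrable.
- by apply: integrable_EFinD;
    [exact: minloss_integrable|exact: leader_integrable].
Qed.

Lemma potential_add_le x h :
  potential (fun i => x i + h i) <= potential x + leadloss x h.
Proof.
rewrite -RintegralD//; [|exact: minloss_integrable|exact: leader_integrable].
apply: le_Rintegral => //; last first.
- move=> z _; rewrite perturbD.
  apply: le_trans (minloss_le S_neq0 _ (leader_in S_neq0 (perturb x z))) _.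
  by rewrite dotD.
- by apply: integrable_EFinD;
    [exact: minloss_integrable|exact: leader_integrable].
- exact: minloss_integrable.
Qed.

Lemma winprob_ge0 x v : 0 <= winprob x v.
Proof. by apply: Rintegral_ge0 => z _; rewrite indicE ler0n. Qed.

(* Translating the perturbation by [h] on the coordinates of [v] compensates for
   the loss [h] of [v], at the cost of the density ratio exp(- v.h). *)
Lemma winprob_add x h v : (forall i, 0 <= h i) ->
  expR (- dot v h) * winprob x v <= winprob (fun i => x i + h i) v.
Proof.
move=> h0; pose a i := (v i)%:R * h i.
have a0 i : 0 <= a i by rewrite mulr_ge0 ?ler0n.
rewrite -lee_fin EFinM !winprobE.
have mA := measurable_wins_perturb (fun i => x i + h i) v.
apply: (@le_trans _ _ (mu ([set z | wins S (perturb (fun i => x i + h i) z) v]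
    `&` rect (fun i => `]a i, +oo[%classic)))); last first.
  apply: le_measure; rewrite ?inE; [|exact: mA|exact: subIsetl].
  by apply: measurableI; [exact: mA|exact: measurable_rect].
rewrite vector_memoryless// lee_pmul2l ?lte_fin ?expR_gt0//.
apply: le_measure; rewrite ?inE.
- exact: measurable_wins_perturb.
- by rewrite -[X in measurable X]setTI; exact: measurable_tshift.
move=> z /= /(wins_increase (h := fun i => (1 - (v i)%:R) * h i)) wz.
rewrite (_ : perturb _ _ =
  fun i => perturb x z i + (1 - (v i)%:R) * h i).
  apply: wz => i; first by rewrite mulr_ge0// subr_ge0; case: (v i).
  by move=> ->; rewrite subrr mul0r.
by apply/funext => i; rewrite /perturb tnth_mktuple /a; ring.
Qed.

Lemma leadloss_le_m x l : (forall i, l i <= 1) -> leadloss x l <= m%:R.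
Proof.
move=> l1; rewrite -[leRHS](Rintegral_prob_cst mu); apply: le_Rintegral => //.
- exact: leader_integrable.
- exact: integrable_prob_cst.
- move=> z _; apply: dot_le_card => //; apply/S_le_m/leader_in => //.
Qed.

Lemma leadloss_potential (s : R) x l : 0 <= s ->
  (forall i, 0 <= l i <= 1) ->
  s * (1 - s * m%:R) * leadloss x l <=
  potential (fun i => x i + s * l i) - potential x.
Proof.
move=> s0 l01.
have l0 i : 0 <= l i by have /andP[] := l01 i.
have l1 i : l i <= 1 by have /andP[] := l01 i.
rewrite lerBrDl; apply: le_trans (potential_add_ge _ _).
rewrite lerD2l !leadlossE mulr_sumr; apply: ler_sum => v _.
rewrite dotZ (_ : _ * _ = s * dot v l * ((1 - s * m%:R) * winprob x v));
  last by ring.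
have [vS|vS] := boolP (v \in S); last first.
  suff w0 y : winprob y v = 0 by rewrite !w0 !mulr0.
  apply: EFin_inj; rewrite winprobE (_ : mkset _ = set0) ?measure0//.
  by apply/seteqP; split => z //=; rewrite /wins (negbTE vS).
rewrite ler_wpM2l//; first by rewrite mulr_ge0// dot_ge0.
apply: le_trans (winprob_add _ _ (h := fun i => s * l i) _); last first.
  by move=> i; rewrite mulr_ge0.
rewrite ler_wpM2r ?winprob_ge0// dotZ.
apply: (@le_trans _ _ (1 - s * dot v l)); last first.
  exact: expR_ge1Dx.
by rewrite lerD2l lerN2 ler_wpM2l//; apply: dot_le_card => //; exact: S_le_m.
Qed.

Lemma potential_step (s del eta : R) x l : 0 <= s <= eta -> s * m%:R <= 1 ->
  0 < del -> (forall i, 0 <= l i <= 1) ->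
  s * (1 - s * m%:R) * (potential x - potential (fun i => x i - del * l i)) <=
  del * (potential (fun i => x i + eta * l i) - potential x + del * m%:R).
Proof.
move=> /andP[s0 seta] sm del0 l01.
have l0 i : 0 <= l i by have /andP[] := l01 i.
have l1 i : l i <= 1 by have /andP[] := l01 i.
set y := (fun i => x i - del * l i).
have yx : (fun i => y i + del * l i) = x by apply/funext => i; rewrite /y subrK.
have up : potential x - potential y <= del * leadloss y l.
  have := potential_add_le y (fun i => del * l i); rewrite yx lerBlDl.
  by rewrite /leadloss; under eq_Rintegral do rewrite dotZ;
    rewrite RintegralZl//; exact: leader_integrable.
have step := leadloss_potential y s0 l01.
have mono : potential (fun i => y i + s * l i) <= potential (fun i => x i + eta * l i).
  apply: le_potential => i; rewrite lerD// ?ler_wpM2r//.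
  by rewrite /y gerBl mulr_ge0// ltW.
have Qm : del * leadloss y l <= del * m%:R.
  by rewrite ler_wpM2l ?(ltW del0)// leadloss_le_m.
have c0 : 0 <= s * (1 - s * m%:R) by rewrite mulr_ge0// subr_ge0.
apply: (le_trans (ler_wpM2l c0 up)).
rewrite mulrCA ler_wpM2l ?(ltW del0)//.
by apply: (le_trans step); lra.
Qed.

Lemma potential_le_minloss x : potential x <= minloss S x.
Proof.
set v := leader S x.
have dv0 : 0 <= \int[mu]_z dot v (tnth z).
  rewrite Rintegral_sum => [|i].
    apply: sumr_ge0 => i _; rewrite RintegralZl ?coord_mean ?mulr1 ?ler0n//.
    exact: coord_integrable.
  apply: integrable_EFinZ; exact: coord_integrable.
apply: (@le_trans _ _ (\int[mu]_z (dot v x - dot v (tnth z)))).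
  apply: le_Rintegral => //.
  - exact: minloss_integrable.
  - by apply: integrable_EFinB; [exact: integrable_prob_cst|exact: dot_tnth_integrable].
  - by move=> z _; rewrite -dotB; apply/minloss_le/leader_in.
rewrite RintegralB//; [|exact: integrable_prob_cst|exact: dot_tnth_integrable].
by rewrite Rintegral_prob_cst /minloss -/v gerBl.
Qed.

Lemma excess_integrable (c : R) i :
  mu.-integrable setT (EFin \o (fun z => Num.max (tnth z i - c) 0)).
Proof.
apply: (@dominated_integrable _ _ _ _ _ (fun z => `|tnth z i| + `|c|)).
- apply: measurable_maxr => //; apply: measurable_funB => //.
  exact: measurable_tnth.
- apply: integrable_EFinD.
    exact: (integrable_norm (coord_integrable i)).
  exact: integrable_prob_cst.
- move=> z; apply: le_trans (ler_normB _ _).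
  by case: (leP (tnth z i - c) 0) => _; rewrite ?normr0.
Qed.

(* Bound z_i by c + (z_i - c)^+ in the leader's coordinates; the excess above
   c = ln(d/m) has mean exp(- c) = m/d in each of the d coordinates. *)
Lemma potential0_ge : (0 < m)%N -> (m <= d)%N ->
  - (m%:R * logterm R d m) <= potential (fun=> 0).
Proof.
move=> m0 md.
have m0R : 0 < m%:R :> R by rewrite ltr0n.
have d0R : 0 < d%:R :> R by rewrite ltr0n (leq_trans m0).
pose c : R := ln (d%:R / m%:R).
have c0 : 0 <= c by rewrite ln_ge0// ler_pdivlMr// mul1r ler_nat.
have expc : expR (- c) = m%:R / d%:R.
  by rewrite expRN lnK ?posrE ?divr_gt0// invf_div.
have iS := integrable_sum_EFin (index_enum 'I_d) (fun i => excess_integrable c i).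
apply: (@le_trans _ _
    (\int[mu]_z (- (m%:R * c) - \sum_(i < d) Num.max (tnth z i - c) 0))).
  rewrite RintegralB//; last exact: integrable_prob_cst.
  rewrite Rintegral_prob_cst Rintegral_sum; last by move=> i; exact: excess_integrable.
  rewrite (eq_bigr (fun=> m%:R / d%:R)) => [|i _].
    rewrite sumr_const card_ord -[_ *+ d]mulr_natr divfK ?gt_eqF//.
    by rewrite /logterm -/c mulrDr mulr1 opprD.
  rewrite /Rintegral (exponential_excess (coord_exponential mu_exp i))//.
apply: le_Rintegral => //.
- by apply: integrable_EFinB => //; exact: integrable_prob_cst.
- exact: minloss_integrable.
move=> z _; rewrite /minloss; set v := leader _ _.
have vm : \sum_(i < d) (v i)%:R <= m%:R :> R.
  by rewrite -natr_sum ler_nat; exact/S_le_m/leader_in.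
have : dot v (tnth z) <= \sum_(i < d) ((v i)%:R * c + Num.max (tnth z i - c) 0).
  apply: ler_sum => i _; case: (v i); rewrite ?mul1r ?mul0r ?add0r.
    by case: (leP (tnth z i - c) 0) => ?; lra.
  by rewrite le_max lexx orbT.
rewrite big_split/= -mulr_suml; have := ler_wpM2r c0 vm.
have -> : dot v (perturb (fun=> 0) z) = - dot v (tnth z).
  by rewrite -[RHS]mulN1r -dotZ; apply: eq_dot => i _; rewrite /perturb; ring.
by lra.
Qed.

End Potential.
(** * Independence of the past *)

Section Freezing.
Context (disp : measure_display) (Omega : measurableType disp) (R : realType).
Variables (P : probability Omega R) (d T : nat) (S : {set action d}) (eta : R).
Hypothesis S_neq0 : S != finset.set0.
Variables (ell Z : 'I_T -> 'I_d -> {RV P >-> R}) (V : 'I_T -> Omega -> action d).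
Hypothesis V_FPL : FPL S eta ell Z V.

(* [past ell Z V t] is by definition the family of measurable sets of
   [g_sigma_algebraType (past_gen t)]. *)
Definition past_gen (t : 'I_T) : set (set Omega) :=
  [set A | exists (s : 'I_T) (i : 'I_d) (B : set R),
      [/\ (s < t)%N, measurable B & A = Z s i @^-1` B]]
  `|` [set A | exists (s : 'I_T) (v : action d),
      (s < t)%N /\ A = V s @^-1` [set v]]
  `|` [set A | exists (s : 'I_T) (i : 'I_d) (B : set R),
      [/\ (s <= t)%N, measurable B & A = ell s i @^-1` B]].

Lemma past_measurable t A : past ell Z V t A -> measurable A.
Proof.
suff : past ell Z V t `<=` measurable by apply.
apply: smallest_sub; first exact: sigma_algebra_measurable.
move=> B [[[s [i [C [_ mC ->]]]]|[s [v [_ ->]]]]|[s [i [C [_ mC ->]]]]].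
- by rewrite -[X in measurable X]setTI; exact: measurable_funP.
- exact: (FPL_measurable V_FPL).
- by rewrite -[X in measurable X]setTI; exact: measurable_funP.
Qed.

Lemma measurable_Ztuple t :
  measurable_fun setT (fun w => [tuple Z t i w | i < d]).
Proof.
apply/measurable_fun_tnthP => i.
by rewrite (_ : _ \o _ = Z t i)//; apply/funext => w /=; rewrite tnth_mktuple.
Qed.

Lemma Ztuple_rect t (B : 'I_d -> set R) : (forall i, measurable (B i)) ->
  P ((fun w => [tuple Z t i w | i < d]) @^-1` rect B) =
  (\prod_(i < d) exponential_prob 1 (B i))%E.
Proof.
move=> mB; transitivity (P (\bigcap_(i in [set: 'I_d]) (Z t i @^-1` B i))).
  congr (P _); apply/seteqP; split => w /=.
    by move=> h i _ /=; have := h i; rewrite tnth_mktuple.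
  by move=> h i; rewrite tnth_mktuple; exact: h.
rewrite (FPL_indep V_FPL t mB); apply: eq_bigr => i _.
by rewrite (FPL_exponential V_FPL).
Qed.

Lemma Ztuple_sigma t A : measurable A ->
  sigma_of (Z t) ((fun w => [tuple Z t i w | i < d]) @^-1` A).
Proof.
pose G : set (set Omega) :=
  [set A | exists i (B : set R), measurable B /\ A = Z t i @^-1` B].
move=> mA.
have : measurable_fun setT
    ((fun w => [tuple Z t i w | i < d]) : g_sigma_algebraType G -> d.-tuple R).
  apply/measurable_fun_tnthP => i _ B mB; rewrite setTI.
  apply: sub_sigma_algebra; exists i, B; split => //.
  by apply/seteqP; split => w /=; rewrite tnth_mktuple.
by move=> /(_ measurableT A mA); rewrite setTI.
Qed.

Lemma Xtuple_past t (X : 'I_d -> Omega -> R) A :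
  (forall i B, measurable B -> past ell Z V t (X i @^-1` B)) ->
  measurable A ->
  past ell Z V t ((fun w => [tuple X i w | i < d]) @^-1` A).
Proof.
move=> mX mA.
have : measurable_fun setT ((fun w => [tuple X i w | i < d]) :
    g_sigma_algebraType (past_gen t) -> d.-tuple R).
  apply/measurable_fun_tnthP => i _ B mB; rewrite setTI.
  rewrite (_ : _ @^-1` B = X i @^-1` B); first exact: mX.
  by apply/seteqP; split => w /=; rewrite tnth_mktuple.
by move=> /(_ measurableT A mA); rewrite setTI.
Qed.

Variables (mu : probability (d.-tuple R) R) (mu_exp : iid_exponential mu).

Lemma Ztuple_law t A : measurable A ->
  P ((fun w => [tuple Z t i w | i < d]) @^-1` A) = mu A.
Proof.
pose Zt : {RV P >-> d.-tuple R} := HB.pack (fun w => [tuple Z t i w | i < d])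
  (isMeasurableFun.Build _ _ _ _ _ (measurable_Ztuple t)).
suff /(_ A) : forall A, measurable A -> distribution P Zt A = mu A by [].
apply: tuple_measure_unique => [|B mB].
  by rewrite ltey_eq fin_num_measure.
exact: etrans (Ztuple_rect t mB) (esym (mu_exp mB)).
Qed.

Lemma freezing t (X : 'I_d -> Omega -> R) (C : R) :
  (forall i B, measurable B -> past ell Z V t (X i @^-1` B)) ->
  (forall i w, `|X i w| <= C) ->
  [/\ P.-integrable setT (EFin \o (fun w => minloss S (fun i => X i w - Z t i w))),
    P.-integrable setT (EFin \o (fun w => potential mu S (X^~ w))) &
  \int[P]_w minloss S (fun i => X i w - Z t i w) =
  \int[P]_w potential mu S (X^~ w)].
Proof.
move=> mX XC.
pose tX w := [tuple X i w | i < d].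
pose tZ w := [tuple Z t i w | i < d].
have mtX : measurable_fun setT tX.
  move=> _ B mB; rewrite setTI.
  by apply: (past_measurable (t := t)); exact: Xtuple_past.
have mXi i : measurable_fun setT (X i).
  rewrite (_ : X i = (fun x : d.-tuple R => tnth x i) \o tX).
    by apply: measurableT_comp => //; exact: measurable_tnth.
  by apply/funext => w /=; rewrite tnth_mktuple.
have mtZ := measurable_Ztuple t.
pose Xr : {RV P >-> d.-tuple R} := HB.pack tX (isMeasurableFun.Build _ _ _ _ _ mtX).
have mW : measurable_fun setT (fun w => (tX w, tZ w)) by exact: measurable_fun_pair.
pose Wr : {RV P >-> (d.-tuple R * d.-tuple R)%type} := HB.pack (fun w => (tX w, tZ w))
  (isMeasurableFun.Build _ _ _ _ _ mW).
pose nu := distribution P Xr.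
pose J := distribution P Wr.
have JE : forall A, measurable A -> (nu \x mu)%E A = J A.
  apply: product_measure_unique => A B mA mB.
  change (P (tX @^-1` A `&` tZ @^-1` B) = (P (tX @^-1` A) * mu B)%E).
  rewrite -(Ztuple_law t mB).
  apply: (FPL_fresh V_FPL (t := t)); first exact: Xtuple_past.
  exact: Ztuple_sigma.
pose f (p : (d.-tuple R * d.-tuple R)%type) : \bar R :=
  (minloss S (perturb (tnth p.1) p.2))%:E.
have mf : measurable_fun setT f.
  apply/measurable_EFinP; apply: measurable_minloss => // i.
  apply: measurable_funB.
    by apply: (measurableT_comp (measurable_tnth i)); exact: measurable_fst.
  by apply: (measurableT_comp (measurable_tnth i)); exact: measurable_snd.
have fW w : f (Wr w) = (minloss S (fun i => X i w - Z t i w))%:E.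
  by congr (minloss S _)%:E; apply/funext => i; rewrite /perturb/= !tnth_mktuple.
have FX w : fubini_F mu f (Xr w) = (potential mu S (X^~ w))%:E.
  have e : tnth (tX w) = X^~ w by apply/funext => i; rewrite tnth_mktuple.
  rewrite /fubini_F /potential /Rintegral fineK.
    by apply: eq_integral => z _; rewrite /f/= e.
  exact: (integrable_fin_num measurableT (minloss_integrable mu_exp S_neq0 (X^~ w))).
have iP : P.-integrable setT
    (EFin \o (fun w => minloss S (fun i => X i w - Z t i w))).
  apply: (@dominated_integrable _ _ _ _ _
    (fun w => \sum_(i < d) (C + `|Z t i w|))).
  - apply: measurable_minloss => // i; exact: measurable_funB.
  - apply: integrable_sum_EFin => i; apply: integrable_EFinD.
      exact: integrable_prob_cst.
    have := exponential_integrable (FPL_exponential V_FPL t i).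
    exact: integrable_norm.
  - move=> w; apply: le_trans (norm_minloss_le _ _) _.
    by apply: ler_sum => i _; apply: le_trans (ler_normB _ _) _; rewrite lerD2r.
have iJ : J.-integrable setT f.
  apply: integrable_pushforward => //.
  by apply: eq_integrable iP => // w _ /=; rewrite fW.
have iN : (nu \x mu)%E.-integrable setT f.
  apply/integrableP; split => //.
  rewrite (eq_measure_integral J); first by have /integrableP[] := iJ.
  by move=> A mA _; exact: JE.
have iF := integrable_fubini_F iN.
have iPX : P.-integrable setT (fubini_F mu f \o Xr).
  apply/integrableP; split.
    by apply: measurableT_comp => //; have /integrableP[] := iF.
  have /integrableP[mF] := iF.
  rewrite ge0_integral_distribution//; exact: measurableT_comp.
have iPot : P.-integrable setT (EFin \o (fun w => potential mu S (X^~ w))).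
  by apply: eq_integrable iPX => // w _ /=; rewrite FX.
split => //; congr fine.
transitivity (\int[J]_p f p)%E.
  rewrite integral_distribution//; first by apply: eq_integral => w _; rewrite /= fW.
  by apply: eq_integrable iP => // w _ /=; rewrite fW.
rewrite (eq_measure_integral (nu \x mu)%E); last first.
  by move=> A mA _; apply/esym; exact: JE.
rewrite -integral12_prod_meas1// integral_distribution//.
  by apply: eq_integral => w _; rewrite /= FX.
by have /integrableP[] := iF.
Qed.

End Freezing.
(** * Regret of FPL *)

Section Rounds.
Context (disp : measure_display) (Omega : measurableType disp) (R : realType).
Variables (P : probability Omega R) (d m T : nat) (S : {set action d}) (eta : R).
Hypothesis S_neq0 : S != finset.set0.
Hypothesis S_le_m : forall v : action d, v \in S -> (\sum_(i < d) v i <= m)%N.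
Hypothesis m_gt0 : (0 < m)%N.
Hypothesis m_le_d : (m <= d)%N.
Variables (ell Z : 'I_T -> 'I_d -> {RV P >-> R}) (V : 'I_T -> Omega -> action d).
Hypothesis ell_bounded : forall t i w, 0 <= ell t i w <= 1.
Hypothesis eta_gt0 : 0 < eta.
Hypothesis V_FPL : FPL S eta ell Z V.

Definition round_loss (t : 'I_T) w : R := dot (V t w) (fun i => ell t i w).

Lemma ell_norm t i w : `|ell t i w| <= 1.
Proof. by have /andP[l0 l1] := ell_bounded t i w; rewrite ger0_norm. Qed.

Lemma round_loss_integrable t : P.-integrable setT (EFin \o round_loss t).
Proof.
apply: (@bounded_integrable _ _ _ _ _ (\sum_(i < d) 1)); last first.
  move=> w; apply: le_trans (norm_dot_le _ _) _.
  by apply: ler_sum => i _; exact: ell_norm.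
rewrite (_ : round_loss t = fun w =>
    \sum_v dot v (fun i => ell t i w) * \1_(V t @^-1` [set v]) w).
  apply: measurable_sum => v; apply: measurable_funM; first exact: measurable_dot.
  exact/measurable_indic/(FPL_measurable V_FPL).
apply/funext => w; rewrite (bigD1 (V t w))//= big1 => [|v vV].
  by rewrite indicE mem_set//= mulr1 addr0.
by rewrite indicE memNset ?mulr0//= => vE; rewrite vE eqxx in vV.
Qed.

Lemma dot_ell_integrable t v :
  P.-integrable setT (EFin \o (fun w => dot v (fun i => ell t i w))).
Proof.
apply: (@bounded_integrable _ _ _ _ _ (\sum_(i < d) 1)); first exact: measurable_dot.
move=> w; apply: le_trans (norm_dot_le _ _) _.
by apply: ler_sum => i _; exact: ell_norm.
Qed.

Lemma cumloss_norm k w i : `|cumloss ell k w i| <= T%:R.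
Proof.
apply: le_trans (ler_norm_sum _ _ _) _.
apply: (@le_trans _ _ (\sum_(s < T) 1)); last by rewrite sumr_const card_ord.
by rewrite big_mkcond; apply: ler_sum => s _; case: ifP => // _; exact: ell_norm.
Qed.

Lemma cumlossS (t : 'I_T) w i :
  cumloss ell t.+1 w i = cumloss ell t w i + ell t i w.
Proof.
rewrite /cumloss (bigD1 t)//= addrC; congr (_ + _).
apply: eq_bigl => s; rewrite ltnS leq_eqVlt -(inj_eq val_inj).
by rewrite andb_orl; case: eqVneq => /= [->|_]; rewrite ?ltnn ?andbT ?orbF//.
Qed.

Lemma measurable_cumloss k i : measurable_fun setT (fun w => cumloss ell k w i).
Proof.
rewrite (_ : (fun w => _) = fun w => \sum_(s < T) (if (s < k)%N then ell s i w else 0)).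
  by apply: measurable_sum => s; case: (s < k)%N.
by apply/funext => w; rewrite /cumloss big_mkcond.
Qed.

Definition shifted_loss (t : 'I_T) (c : R) i w : R :=
  eta * cumloss ell t w i + c * ell t i w.

Lemma shifted_loss_past t c i B : measurable B ->
  past ell Z V t (shifted_loss t c i @^-1` B).
Proof.
move=> mB; pose G := past_gen ell Z V t.
have me (s : 'I_T) : (s <= t)%N ->
    measurable_fun setT (ell s i : g_sigma_algebraType G -> R).
  move=> st _ C mC; rewrite setTI; apply: sub_sigma_algebra.
  by right; exists s, i, C.
have : measurable_fun setT (shifted_loss t c i : g_sigma_algebraType G -> R).
  apply: measurable_funD; apply: measurable_funM => //; last exact: me.
  rewrite (_ : (fun w => _) =
      fun w => \sum_(s < T) (if (s < t)%N then ell s i w else 0)).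
    apply: measurable_sum => s; case: (boolP (s < t)%N) => [st|_];
      last exact: measurable_cst.
    exact: (me s (ltnW st)).
  by apply/funext => w; rewrite /cumloss big_mkcond.
by move=> /(_ measurableT B mB); rewrite setTI.
Qed.

Lemma shifted_loss_norm t c i w : `|shifted_loss t c i w| <= eta * T%:R + `|c|.
Proof.
apply: le_trans (ler_normD _ _) _; rewrite !normrM (gtr0_norm eta_gt0).
apply: lerD; first by rewrite ler_wpM2l ?(ltW eta_gt0)// cumloss_norm.
by rewrite ler_piMr// ell_norm.
Qed.

Variables (mu : probability (d.-tuple R) R) (mu_exp : iid_exponential mu).

Definition mean_potential k : R :=
  \int[P]_w potential mu S (fun i => eta * cumloss ell k w i).

Lemma round_bound (s : R) t : 0 <= s <= eta -> s * m%:R <= 1 ->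
  s * (1 - s * m%:R) * (\int[P]_w round_loss t w) <=
  mean_potential t.+1 - mean_potential t.
Proof.
move=> seta sm; have /andP[s0 _] := seta.
have c0 : 0 <= s * (1 - s * m%:R) by rewrite mulr_ge0// subr_ge0.
have frz (c : R) := freezing S_neq0 V_FPL mu_exp (@shifted_loss_past t c)
  (shifted_loss_norm t c).
have E0 w : (shifted_loss t 0)^~ w = (fun i => eta * cumloss ell t w i).
  by apply/funext => i; rewrite /shifted_loss mul0r addr0.
have E1 w : (shifted_loss t eta)^~ w = (fun i => eta * cumloss ell t.+1 w i).
  by apply/funext => i; rewrite /shifted_loss cumlossS mulrDr.
have mR : 0 < m%:R :> R by rewrite ltr0n.
apply/ler_addgt0Pr => e e0; pose del := e / m%:R.
have del0 : 0 < del by rewrite divr_gt0.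
have [ig0 ip0 e0_] := frz 0; have [ig1 ip1 e1_] := frz (- del).
have [_ ip2 _] := frz eta.
have qle : del * (\int[P]_w round_loss t w) <=
    \int[P]_w (potential mu S ((shifted_loss t 0)^~ w) -
               potential mu S ((shifted_loss t (- del))^~ w)).
  rewrite RintegralB// -e0_ -e1_ -RintegralB// -RintegralZl//; last first.
    exact: round_loss_integrable.
  apply: le_Rintegral => //.
  - exact/integrable_EFinZ/round_loss_integrable.
  - exact: integrable_EFinB.
  move=> w _; set y := (fun i => shifted_loss t 0 i w - Z t i w).
  have yE : y = (fun i => eta * cumloss ell t w i - Z t i w).
    by apply/funext => i; rewrite /y /shifted_loss mul0r addr0.
  have Vy : dot (V t w) y = minloss S y.
    apply: minloss_attained => //; first exact: (FPL_action V_FPL).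
    by move=> u uS; rewrite yE; exact: (FPL_argmin V_FPL).
  rewrite lerBrDl -lerBrDr -Vy -dotZ -dotB.
  rewrite (_ : (fun i => shifted_loss t (- del) i w - Z t i w) =
    (fun i => y i - del * ell t i w)); last first.
    by apply/funext => i; rewrite /y /shifted_loss; ring.
  exact/minloss_le/(FPL_action V_FPL).
rewrite -(ler_pM2l del0) mulrCA; apply: (le_trans (ler_wpM2l c0 qle)).
have -> : mean_potential t.+1 = \int[P]_w potential mu S ((shifted_loss t eta)^~ w).
  by apply: eq_Rintegral => w _; rewrite E1.
have -> : mean_potential t = \int[P]_w potential mu S ((shifted_loss t 0)^~ w).
  by apply: eq_Rintegral => w _; rewrite E0.
rewrite -RintegralZl//; last exact: integrable_EFinB.
rewrite -RintegralB// -[e in leRHS](Rintegral_prob_cst P) -RintegralD//; last 2 first.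
- exact: integrable_EFinB.
- exact: integrable_prob_cst.
rewrite -RintegralZl//; last first.
  by apply: integrable_EFinD; [exact: integrable_EFinB|exact: integrable_prob_cst].
apply: le_Rintegral => //.
- exact/integrable_EFinZ/integrable_EFinB.
- by apply/integrable_EFinZ/integrable_EFinD;
    [exact: integrable_EFinB|exact: integrable_prob_cst].
move=> w _; have := potential_step mu_exp S_neq0 S_le_m
  (fun i => eta * cumloss ell t w i) seta sm del0 (ell_bounded t ^~ w).
rewrite -E0 (_ : (fun i => _ - _) = (shifted_loss t (- del))^~ w); last first.
  by apply/funext => i; rewrite /shifted_loss; ring.
rewrite (_ : (fun i => _ + _) = (shifted_loss t eta)^~ w); last first.
  by apply/funext => i; rewrite /shifted_loss; ring.
by rewrite /del divfK// gt_eqF.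
Qed.

Lemma cumloss_ge0 k w i : 0 <= cumloss ell k w i.
Proof. by apply: sumr_ge0 => s _; have /andP[] := ell_bounded s i w. Qed.

Lemma minloss_cumloss_integrable k :
  P.-integrable setT (EFin \o (fun w => minloss S (cumloss ell k w))).
Proof.
apply: (@bounded_integrable _ _ _ _ _ (\sum_(i < d) T%:R)).
  by apply: measurable_minloss => // i; exact: measurable_cumloss.
move=> w; apply: le_trans (norm_minloss_le _ _) _.
by apply: ler_sum => i _; exact: cumloss_norm.
Qed.

Lemma mean_potential0 : mean_potential 0 = potential mu S (fun=> 0).
Proof.
rewrite -[RHS](Rintegral_prob_cst P); apply: eq_Rintegral => w _.
congr (potential mu S _); apply/funext => i.
by rewrite /cumloss big_pred0 ?mulr0.
Qed.

Lemma mean_potential_le (t : 'I_T) :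
  mean_potential t.+1 <= eta * \int[P]_w minloss S (cumloss ell t.+1 w).
Proof.
have [_ ip _] := freezing S_neq0 V_FPL mu_exp (@shifted_loss_past t eta)
  (shifted_loss_norm t eta).
rewrite -RintegralZl//; last exact: minloss_cumloss_integrable.
apply: le_Rintegral => //.
- apply: eq_integrable ip => // w _ /=; congr (potential mu S _)%:E.
  by apply/funext => i; rewrite /shifted_loss cumlossS mulrDr.
- exact/integrable_EFinZ/minloss_cumloss_integrable.
- move=> w _; apply: le_trans (potential_le_minloss mu_exp S_neq0 _) _.
  by rewrite minlossZ// ltW.
Qed.

Lemma total_bound (s : R) : (0 < T)%N -> 0 <= s <= eta -> s * m%:R <= 1 ->
  s * (1 - s * m%:R) * (\sum_(t < T) \int[P]_w round_loss t w) <=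
  eta * (\int[P]_w minloss S (cumloss ell T w)) + m%:R * logterm R d m.
Proof.
move=> T0 seta sm; rewrite mulr_sumr.
apply: (@le_trans _ _ (\sum_(t < T) (mean_potential t.+1 - mean_potential t))).
  by apply: ler_sum => t _; exact: round_bound.
rewrite -(big_mkord xpredT (fun t => mean_potential t.+1 - mean_potential t)).
rewrite telescope_sumr// mean_potential0 lerD//.
  have := mean_potential_le (Ordinal (eq_leq (prednK T0))).
  by rewrite /= prednK.
by rewrite lerNl; exact: potential0_ge.
Qed.

Lemma expectation_Rintegral (f : Omega -> R) :
  P.-integrable setT (EFin \o f) -> ('E_P[f] = (\int[P]_w f w)%:E)%E.
Proof.
move=> fi; rewrite unlock /Rintegral fineK//.
exact: (integrable_fin_num measurableT fi).
Qed.

Lemma expected_lossE :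
  expected_loss ell V = (\sum_(t < T) \int[P]_w round_loss t w)%:E.
Proof.
rewrite /expected_loss -sumEFin; apply: eq_bigr => t _.
exact: (expectation_Rintegral (round_loss_integrable t)).
Qed.

Lemma dot_cumloss v w :
  dot v (cumloss ell T w) = \sum_(t < T) dot v (fun i => ell t i w).
Proof.
rewrite -dot_sum; apply: eq_dot => i _.
by rewrite /cumloss; apply: eq_bigl => t; rewrite ltn_ord.
Qed.

Lemma dot_cumloss_integrable v :
  P.-integrable setT (EFin \o (fun w => dot v (cumloss ell T w))).
Proof.
have := integrable_sum_EFin (index_enum 'I_T) (fun t => dot_ell_integrable t v).
by apply: eq_integrable => // w _; rewrite /= dot_cumloss.
Qed.

Lemma regret_le (b : R) :
  \sum_(t < T) (\int[P]_w round_loss t w) -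
    \int[P]_w minloss S (cumloss ell T w) <= b ->
  (regret S ell V <= b%:E)%E.
Proof.
move=> hb; apply: bigmax_le => [|v vS]; first exact: leNye.
have -> : (\sum_(t < T) 'E_P[fun w => (dot (V t w) (fun i => ell t i w)
      - dot v (fun i => ell t i w))%R])%E =
    (\sum_(t < T) (\int[P]_w round_loss t w) -
      \int[P]_w dot v (cumloss ell T w))%:E.
  transitivity (\sum_(t < T) (\int[P]_w round_loss t w -
      \int[P]_w dot v (fun i => ell t i w))%:E)%E.
    apply: eq_bigr => t _; rewrite expectation_Rintegral.
      rewrite RintegralB//; [exact: round_loss_integrable|exact: dot_ell_integrable].
    apply: integrable_EFinB; [exact: round_loss_integrable|exact: dot_ell_integrable].
  rewrite sumEFin sumrB; congr (_ - _)%:E.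
  rewrite -Rintegral_sum; last by move=> t; exact: dot_ell_integrable.
  by apply: eq_Rintegral => w _; rewrite dot_cumloss.
rewrite lee_fin; apply: le_trans hb; rewrite lerD2l lerN2.
apply: le_Rintegral => //.
- exact: minloss_cumloss_integrable.
- exact: dot_cumloss_integrable.
- by move=> w _; exact: minloss_le.
Qed.

Lemma best_lossE w : best_loss S ell w = (minloss S (cumloss ell T w))%:E.
Proof.
apply/eqP; rewrite eq_le; apply/andP; split.
  rewrite /best_loss (bigD1 (leader S (cumloss ell T w)))/=; last exact: leader_in.
  by rewrite ge_min lexx.
apply: le_bigmin => [|v vS]; first exact: leey.
by rewrite lee_fin minloss_le.
Qed.

Lemma minloss_cumloss_ge0 w : 0 <= minloss S (cumloss ell T w).
Proof. by apply: dot_ge0 => i; exact: cumloss_ge0. Qed.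

End Rounds.
Lemma tuned_bound (R : realType) (X L K M eta : R) :
  0 < eta -> 0 <= L -> 1 <= K -> 1 <= M ->
  eta = (if L == 0 then 1 / 2 else Num.min (Num.sqrt (K / L)) (1 / 2)) ->
  (forall s, 0 <= s <= eta -> s * M <= 1 -> s * (1 - s * M) * X <= eta * L + M * K) ->
  X - L <= 4 * M * Num.max (Num.sqrt (L * K)) ((M ^+ 2 + 1) * K).
Proof.
move=> eta0 L0 K1 M1 etaE main.
have K0 : 0 < K by lra.
have M0 : 0 < M by lra.
have [etaL etaV] : eta ^+ 2 * L <= K /\
    (eta = 1 / 2 \/ eta * L = Num.sqrt (L * K) /\ eta ^+ 2 * L = K).
  move: etaE; case: eqVneq => [->|Ln0] etaE; first by rewrite mulr0; split; [lra|left].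
  have Lp : 0 < L by rewrite lt_neqAle eq_sym Ln0.
  have KL : 0 <= K / L by rewrite divr_ge0// ltW.
  have sqE : Num.sqrt (K / L) ^+ 2 * L = K by rewrite sqr_sqrtr// divfK.
  move: etaE; case: (leP (Num.sqrt (K / L)) (1 / 2)) => [_|lt2] etaE.
    rewrite -etaE in sqE; rewrite sqE; split => //; right; split => //.
    rewrite -[in RHS]sqE (_ : L * _ = (eta * L) ^+ 2); last by ring.
    by rewrite sqrtr_sqr ger0_norm// mulr_ge0// ltW.
  split; last by left.
  rewrite -[leRHS]sqE ler_wpM2r// ler_sqr ?nnegrE ?sqrtr_ge0 ?(ltW eta0)//.
  by rewrite etaE; exact: ltW.
have [small|large] := leP (eta * M) (1 / 2).
  have : eta * (1 - eta * M) * X <= eta * L + M * K.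
    by apply: main; [rewrite lexx ltW|lra].
  move=> h.
  have {h}h : eta * (X - L) <= 2 * M * K + 2 * M * (eta ^+ 2 * L).
    case: (leP X L) => XL.
      apply: (@le_trans _ _ 0); first by rewrite pmulr_rle0// subr_le0.
      by rewrite addr_ge0// !mulr_ge0// ?sqr_ge0// ltW.
    suff : eta * (1 - eta * M) * (X - L) <= M * K + M * (eta ^+ 2 * L).
      have : 1 / 2 * (eta * (X - L)) <= (1 - eta * M) * (eta * (X - L)).
        by rewrite ler_wpM2r ?mulr_ge0 ?subr_ge0 ?(ltW eta0) ?(ltW M0) ?(ltW K0)//; lra.
      by lra.
    by lra.
  case: etaV => [e2|[eL eK]].
    apply: (@le_trans _ _ (4 * M * ((M ^+ 2 + 1) * K))); last first.
      by rewrite ler_wpM2l ?mulr_ge0 ?(ltW M0)// le_max lexx orbT.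
    have : M * (eta ^+ 2 * L) <= M * K by rewrite ler_wpM2l// ltW.
    have : M * K * 1 <= M * K * M ^+ 2.
      by rewrite ler_wpM2l ?mulr_ge0 ?exprn_ege1 ?(ltW eta0) ?(ltW M0) ?(ltW K0).
    by rewrite e2 in h *; lra.
  apply: (@le_trans _ _ (4 * M * Num.sqrt (L * K))); last first.
    by rewrite ler_wpM2l ?mulr_ge0 ?(ltW M0)// le_max lexx.
  by rewrite -eL -(ler_pM2l eta0); move: h; rewrite -eK; lra.
apply: (@le_trans _ _ (4 * M * ((M ^+ 2 + 1) * K))); last first.
  by rewrite ler_wpM2l ?mulr_ge0 ?(ltW M0)// le_max lexx orbT.
have : 1 / (2 * M) * (1 - 1 / (2 * M) * M) * X <= eta * L + M * K.
  apply: main.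
    rewrite divr_ge0 ?mulr_ge0 ?(ltW M0)//= ler_pdivrMr ?mulr_gt0//.
    by lra.
  by rewrite (_ : 1 / (2 * M) * M = 1 / 2); [lra|field; rewrite gt_eqF].
rewrite (_ : _ * _ * X = X / (4 * M)); last by field; rewrite gt_eqF.
rewrite ler_pdivrMr ?mulr_gt0// => h.
have : L * (4 * M * eta - 1) <= 4 * M ^+ 2 * K.
  have y1 : 0 <= 4 * M * eta - 1 by lra.
  have e2 : 0 < eta ^+ 2 by rewrite exprn_gt0.
  rewrite -(ler_pM2l e2) mulrA.
  apply: (le_trans (ler_wpM2r y1 etaL)).
  rewrite -subr_ge0 (_ : _ - _ = K * (2 * M * eta - 1) ^+ 2); last by ring.
  by rewrite mulr_ge0 ?sqr_ge0 ?(ltW eta0) ?(ltW M0) ?(ltW K0).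
have : 4 * M * K * 0 <= 4 * M * K * (M - 1) ^+ 2.
  by rewrite ler_wpM2l ?sqr_ge0 ?mulr_ge0 ?(ltW eta0) ?(ltW M0) ?(ltW K0).
by lra.
Qed.
Theorem theorem13 (R : realType) (disp : measure_display)
  (Omega : measurableType disp) (P : probability Omega R)
  (d m T : nat) (m_gt0 : (0 < m)%N) (m_le_d : (m <= d)%N) (T_gt0 : (0 < T)%N)
  (S : {set action d}) (S_neq0 : S != finset.set0)
  (S_le_m : forall v : action d, v \in S -> (\sum_(i < d) v i <= m)%N)
  (ell Z : 'I_T -> 'I_d -> {RV P >-> R})
  (ell_bounded : forall t i w, 0 <= ell t i w <= 1)
  (V : 'I_T -> Omega -> action d)
  (eta : R) (eta_gt0 : 0 < eta) (V_FPL : FPL S eta ell Z V) :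
  (regret S ell V <=
     (m%:R * logterm R d m / eta)%:E + (eta * m%:R)%:E * expected_loss ell V)%E
  /\
  (forall Lstar : R,
     {ae P, forall w, best_loss S ell w = Lstar%:E} ->
     eta = tuned_eta d m Lstar ->
     (regret S ell V <=
        (4 * m%:R * Num.max (Num.sqrt (Lstar * logterm R d m))
                            ((m%:R ^+ 2 + 1) * logterm R d m))%:E)%E).
Proof.
have [t0] : exists t : 'I_T, True by exists (Ordinal T_gt0).
move=> _.
pose Zt : {RV P >-> d.-tuple R} := HB.pack (fun w => [tuple Z t0 i w | i < d])
  (isMeasurableFun.Build _ _ _ _ _ (measurable_Ztuple Z t0)).
pose mu : probability (d.-tuple R) R := distribution P Zt.
have mu_exp : iid_exponential mu by move=> B mB; exact: (Ztuple_rect V_FPL t0 mB).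
have bound s := total_bound S_neq0 S_le_m m_gt0 m_le_d ell_bounded eta_gt0 V_FPL
  mu_exp (s := s) T_gt0.
rewrite (expected_lossE ell_bounded V_FPL).
set X := \sum_(t < T) _ in bound *.
set L := \int[P]_w minloss S (cumloss ell T w) in bound.
have mR : 1 <= m%:R :> R by rewrite ler1n.
have K1 : 1 <= logterm R d m.
  by rewrite /logterm lerDr ln_ge0// ler_pdivlMr ?ltr0n// mul1r ler_nat.
have L0 : 0 <= L.
  by apply: Rintegral_ge0 => w _; apply: minloss_cumloss_ge0.
have X0 : 0 <= X.
  apply: sumr_ge0 => t _; apply: Rintegral_ge0 => w _; apply: dot_ge0 => i.
  by have /andP[] := ell_bounded t i w.
split=> [|Lstar Lae etaE].
  rewrite -EFinM -EFinD; apply: (regret_le S_neq0 ell_bounded V_FPL).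
  have qE : eta * (m%:R * logterm R d m / eta) = m%:R * logterm R d m.
    by rewrite mulrC divfK// gt_eqF.
  rewrite -/X -/L -(ler_pM2l eta_gt0).
  move: qE; set q := _ / eta => qE.
  have [small|large] := leP (eta * m%:R) 1.
    by have := bound eta; rewrite lexx ltW// => /(_ isT small); lra.
  have : 0 <= eta * X * (eta * m%:R - 1).
    by rewrite !mulr_ge0 ?subr_ge0 ?(ltW eta_gt0) ?(ltW large).
  have : 0 <= eta * L by rewrite mulr_ge0// ltW.
  have : 0 <= m%:R * logterm R d m by rewrite mulr_ge0// (le_trans ler01).
  by lra.
have LE : L = Lstar.
  rewrite -(Rintegral_prob_cst P Lstar) /L /Rintegral; congr fine.
  apply: ae_eq_integral => //.
  - by have /integrableP[] := minloss_cumloss_integrable S_neq0 ell_bounded T.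
  - by apply: filterS Lae => w; rewrite (best_lossE S_neq0) => -[->].
apply: (regret_le S_neq0 ell_bounded V_FPL).
rewrite -/X -/L LE; apply: (tuned_bound (eta := eta)) => //.
- by rewrite -LE.
- by move=> s s01 sm; have := bound s s01 sm; rewrite LE.
Qed.
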